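(* Let $\mathbb{P}$ be the set of prime numbers. Assume the Polignac conjecture: for every positive even integer $2h$ there exist infinitely many pairs $(p,q)$ of consecutive primes with $p-q=2h$. Then $\mathbb{P}$ is not a spectrum of any Borel probability measure on $\mathbb{R}$, i.e. there is no Borel probability measure $\mu$ on $\mathbb{R}$ for which $E(\mathbb{P})=\{e^{2\pi i p x}:p\in\mathbb{P}\}$ is an orthonormal basis of $L^2(\mu)$. In particular, there is no singular continuous Borel probability measure $\mu$ on $\mathbb{R}$ for which $E(\mathbb{P})$ is an orthonormal basis for $L^2(\mu)$.
   Context: A countable set $\Lambda\subseteq\mathbb{R}$ is a spectrum of a Borel probability measure $\mu$ on $\mathbb{R}$ if the family $E(\Lambda)=\{e_\lambda(x)=e^{2\pi i\lambda x}:\lambda\in\Lambda\}$ (indexed by $\Lambda$) is an orthonormal basis of the complex Hilbert space $L^2(\mu)$, i.e. it is orthonormal and has dense linear span. A measure is singular continuous if it has no atoms and is mutually singular with Lebesgue measure. Primes $q<p$ are consecutive if there is no prime strictly between them. *)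

(* Defs.v *)
From mathcomp Require Export all_boot all_order all_algebra complex.
From mathcomp Require Export all_classical all_reals all_analysis.

Set Implicit Arguments.
Unset Strict Implicit.
Unset Printing Implicit Defensive.

Import Order.TTheory GRing.Theory Num.Theory.
Import numFieldNormedType.Exports.

Local Open Scope classical_set_scope.
Local Open Scope ring_scope.
Local Open Scope complex_scope.

Section complex_L2.
Context (d : measure_display) (T : measurableType d) (R : realType).
Variable mu : {measure set T -> \bar R}.

Definition cintegral (f : T -> R[i]) : R[i] :=
  (\int[mu]_x complex.Re (f x)) +i* (\int[mu]_x complex.Im (f x)).

(* Elements of L^2(mu) are handled through representatives: the norm below is
   only a seminorm on functions, and its null functions are those that vanish
   mu-almost everywhere. *)
Definition L2norm (f : T -> R[i]) : \bar R :=
  'N[mu]_2%:E[EFin \o (@Normc.normc R \o f)].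

Definition in_L2 (f : T -> R[i]) : Prop :=
  [/\ measurable_fun setT (fun x => complex.Re (f x)),
      measurable_fun setT (fun x => complex.Im (f x)) &
      (L2norm f < +oo)%E].

Definition L2inner (f g : T -> R[i]) : R[i] :=
  cintegral (fun x => f x * ((g x)^*)%C).

Definition orthonormal_basis (I : choiceType) (A : set I)
    (e : I -> T -> R[i]) : Prop :=
  [/\ forall i, A i -> in_L2 (e i),
      forall i j, A i -> A j -> L2inner (e i) (e j) = (i == j)%:R &
      forall f, in_L2 f -> forall eps : R, 0 < eps ->
        exists (s : seq I) (c : I -> R[i]), (forall i, i \in s -> A i) /\
          (L2norm (fun x => f x - \sum_(i <- s) c i * e i x)%R < eps%:E)%E].

End complex_L2.

Section spectrum.
Context {R : realType}.

Definition exponential (lambda : R) (x : measurableTypeR R) : R[i] :=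
  cos (2 * pi * lambda * x) +i* sin (2 * pi * lambda * x).

Definition is_spectrum (mu : probability (measurableTypeR R) R)
    (Lambda : set R) : Prop :=
  countable Lambda /\ orthonormal_basis mu Lambda exponential.

Definition mutually_singular (mu nu : set (measurableTypeR R) -> \bar R) : Prop :=
  exists N : set (measurableTypeR R),
    [/\ measurable N, mu N = 0%E & nu (~` N) = 0%E].

Definition singular_continuous (mu : set (measurableTypeR R) -> \bar R) : Prop :=
  (forall x : R, mu [set x] = 0%E) /\ mutually_singular mu lebesgue_measure.

End spectrum.

Definition prime_set (R : realType) : set R :=
  [set p%:R | p in [set p : nat | prime p]].

Definition consecutive_primes (q p : nat) : Prop :=
  [/\ prime q, prime p, (q < p)%N & forall r : nat, prime r -> ~ (q < r < p)%N].

Definition polignac_conjecture : Prop :=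
  forall h : nat, (0 < h)%N ->
    infinite_set [set pq : nat * nat |
      consecutive_primes pq.2 pq.1 /\ (pq.1 - pq.2 = 2 * h)%N].

(* Main.v *)
(* If E(P) is an orthonormal basis of L^2(mu), then the Fourier transform of mu
   vanishes at every difference of two distinct primes, hence, by the Polignac
   conjecture, at every nonzero even integer.  So the exponentials with odd
   integer frequencies are pairwise orthogonal; in particular e_9 and e_15 are
   orthonormal, and both are orthogonal to e_p for every odd prime p.  Some
   nontrivial combination of e_9 and e_15 is also orthogonal to e_2, hence to
   the whole basis, which contradicts completeness. *)
Require Import Defs.
From mathcomp Require Import measurable_realfun ring lra zify.

Set Implicit Arguments.
Unset Strict Implicit.
Unset Printing Implicit Defensive.

Import Order.TTheory GRing.Theory Num.Theory.
Import numFieldNormedType.Exports.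

Local Open Scope classical_set_scope.
Local Open Scope ring_scope.
Local Open Scope complex_scope.

(** * Real and imaginary parts of complex numbers *)

Section complex_parts.
Context (R : rcfType).
Implicit Types x y : R[i].

Lemma ReD x y : complex.Re (x + y) = complex.Re x + complex.Re y.
Proof. by case: x y => [a b] [c d]. Qed.

Lemma ImD x y : complex.Im (x + y) = complex.Im x + complex.Im y.
Proof. by case: x y => [a b] [c d]. Qed.

Lemma ReM x y : complex.Re (x * y) =
  complex.Re x * complex.Re y - complex.Im x * complex.Im y.
Proof. by case: x y => [a b] [c d]. Qed.

Lemma ImM x y : complex.Im (x * y) =
  complex.Re x * complex.Im y + complex.Im x * complex.Re y.
Proof. by case: x y => [a b] [c d]. Qed.

Lemma ReJ x : complex.Re x^*%C = complex.Re x.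
Proof. by case: x. Qed.

Lemma ImJ x : complex.Im x^*%C = - complex.Im x.
Proof. by case: x. Qed.

Lemma normc_ge0 x : 0 <= Normc.normc x.
Proof. by case: x => a b; exact: sqrtr_ge0. Qed.

End complex_parts.

(** * Bounded measurable functions *)

Section bounded_measurable.
Context (d : measure_display) (T : measurableType d) (R : realType).

(** This class is closed under sums and products and, for a probability measure, lies in every
    [L^p]. It contains all functions met below, so it settles every integrability condition. *)
Definition bounded_rmeasurable (f : T -> R) : Prop :=
  measurable_fun setT f /\ exists M : R, forall x, `|f x| <= M.

Definition bounded_measurable (f : T -> R[i]) : Prop :=
  bounded_rmeasurable (fun x => complex.Re (f x)) /\
  bounded_rmeasurable (fun x => complex.Im (f x)).

Lemma bounded_rmeasurable_cst (r : R) : bounded_rmeasurable (fun=> r).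
Proof. by split; [exact: measurable_cst | exists `|r|]. Qed.

Lemma bounded_rmeasurableD (f g : T -> R) :
  bounded_rmeasurable f -> bounded_rmeasurable g ->
  bounded_rmeasurable (fun x => f x + g x).
Proof.
move=> [mf [M fM]] [mg [N gN]]; split; first exact: measurable_funD.
by exists (M + N) => x; rewrite (le_trans (ler_normD _ _))// lerD.
Qed.

Lemma bounded_rmeasurableM (f g : T -> R) :
  bounded_rmeasurable f -> bounded_rmeasurable g ->
  bounded_rmeasurable (fun x => f x * g x).
Proof.
move=> [mf [M fM]] [mg [N gN]]; split; first exact: measurable_funM.
by exists (M * N) => x; rewrite normrM ler_pM.
Qed.

Lemma bounded_rmeasurableN (f : T -> R) :
  bounded_rmeasurable f -> bounded_rmeasurable (fun x => - f x).
Proof.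
move=> [mf [M fM]]; split; first exact: measurableT_comp.
by exists M => x; rewrite normrN.
Qed.

Lemma bounded_measurable_cst (z : R[i]) : bounded_measurable (fun=> z).
Proof. by split; exact: bounded_rmeasurable_cst. Qed.

Lemma bounded_measurableD (f g : T -> R[i]) :
  bounded_measurable f -> bounded_measurable g ->
  bounded_measurable (fun x => f x + g x).
Proof.
move=> [rf jf] [rg jg]; split.
- by under eq_fun do rewrite ReD; exact: bounded_rmeasurableD.
- by under eq_fun do rewrite ImD; exact: bounded_rmeasurableD.
Qed.

Lemma bounded_measurableM (f g : T -> R[i]) :
  bounded_measurable f -> bounded_measurable g ->
  bounded_measurable (fun x => f x * g x).
Proof.
move=> [rf jf] [rg jg]; split.
- under eq_fun do rewrite ReM.
  apply: bounded_rmeasurableD; first exact: bounded_rmeasurableM.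
  by apply: bounded_rmeasurableN; exact: bounded_rmeasurableM.
- under eq_fun do rewrite ImM.
  by apply: bounded_rmeasurableD; exact: bounded_rmeasurableM.
Qed.

Lemma bounded_measurableJ (f : T -> R[i]) :
  bounded_measurable f -> bounded_measurable (fun x => (f x)^*%C).
Proof.
move=> [rf jf]; split.
- by under eq_fun do rewrite ReJ.
- by under eq_fun do rewrite ImJ; exact: bounded_rmeasurableN.
Qed.

Lemma bounded_measurable_sum (I : Type) (s : seq I) (f : I -> T -> R[i]) :
  (forall i, bounded_measurable (f i)) ->
  bounded_measurable (fun x => \sum_(i <- s) f i x).
Proof.
move=> bf; elim: s => [|i s ih].
  by under eq_fun do rewrite big_nil; exact: bounded_measurable_cst.
by under eq_fun do rewrite big_cons; exact: bounded_measurableD.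
Qed.

Lemma bounded_rmeasurable_normc (f : T -> R[i]) :
  bounded_measurable f -> bounded_rmeasurable (fun x => Normc.normc (f x)).
Proof.
move=> [[mr [M rM]] [mj [N jN]]].
have normcE x :
    Normc.normc (f x) = Num.sqrt (complex.Re (f x) ^+ 2 + complex.Im (f x) ^+ 2).
  by case: (f x).
split.
  under eq_fun do rewrite normcE.
  apply: (measurableT_comp (f := @Num.sqrt R)).
    by apply: continuous_measurable_fun; exact: sqrt_continuous.
  by apply: measurable_funD; exact: measurable_funX.
exists (Num.sqrt (M ^+ 2 + N ^+ 2)) => x.
have sqr_le (a b : R) : `|a| <= b -> a ^+ 2 <= b ^+ 2.
  by move=> ab; rewrite -(real_normK (num_real a)) lerXn2r// nnegrE (le_trans _ ab).
by rewrite normcE ger0_norm ?sqrtr_ge0// ler_wsqrtr// lerD// sqr_le.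
Qed.

End bounded_measurable.

(** * The inner product of [L^2(mu)] on bounded functions *)

Section inner_product.
Context (d : measure_display) (T : measurableType d) (R : realType).
Variable mu : probability T R.
Implicit Types f g h : T -> R[i].

Lemma bounded_rmeasurable_integrable (f : T -> R) :
  bounded_rmeasurable f -> mu.-integrable setT (EFin \o f).
Proof.
move=> [mf [M fM]]; apply: measurable_bounded_integrable => //.
  by rewrite -ge0_fin_numE ?fin_num_measure.
by exists M; split; [exact: num_real | move=> N MN x _; exact: le_trans (ltW MN)].
Qed.

Lemma cintegralD f g : bounded_measurable f -> bounded_measurable g ->
  cintegral mu (fun x => f x + g x) = cintegral mu f + cintegral mu g.
Proof.
move=> [rf jf] [rg jg]; rewrite /cintegral.
under eq_Rintegral do rewrite ReD.
under [X in _ +i* X]eq_Rintegral do rewrite ImD.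
by rewrite !RintegralD//; exact: bounded_rmeasurable_integrable.
Qed.

Lemma cintegralZ (z : R[i]) f : bounded_measurable f ->
  cintegral mu (fun x => z * f x) = z * cintegral mu f.
Proof.
move=> [/bounded_rmeasurable_integrable rf /bounded_rmeasurable_integrable jf].
case: z => a b; rewrite /cintegral.
have iZ (r : R) (h : T -> R) : mu.-integrable setT (EFin \o h) ->
    mu.-integrable setT (EFin \o (fun x => r * h x)).
  by move=> ih; exact: (integrableZl _ r ih).
under eq_Rintegral do rewrite ReM/= -mulNr.
under [X in _ +i* X]eq_Rintegral do rewrite ImM/=.
rewrite !RintegralD//; try exact: iZ.
by rewrite !RintegralZl//; simpc => /=.
Qed.

Lemma L2innerDl f g h : bounded_measurable f -> bounded_measurable g ->
    bounded_measurable h ->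
  L2inner mu (fun x => f x + g x) h = L2inner mu f h + L2inner mu g h.
Proof.
move=> bf bg bh; rewrite /L2inner -cintegralD.
- by congr cintegral; apply/funext => x; rewrite mulrDl.
- by apply: bounded_measurableM => //; exact: bounded_measurableJ.
- by apply: bounded_measurableM => //; exact: bounded_measurableJ.
Qed.

Lemma L2innerDr f g h : bounded_measurable f -> bounded_measurable g ->
    bounded_measurable h ->
  L2inner mu f (fun x => g x + h x) = L2inner mu f g + L2inner mu f h.
Proof.
move=> bf bg bh; rewrite /L2inner -cintegralD.
- by congr cintegral; apply/funext => x; rewrite rmorphD mulrDr.
- by apply: bounded_measurableM => //; exact: bounded_measurableJ.
- by apply: bounded_measurableM => //; exact: bounded_measurableJ.
Qed.

Lemma L2innerZl (z : R[i]) f g : bounded_measurable f -> bounded_measurable g ->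
  L2inner mu (fun x => z * f x) g = z * L2inner mu f g.
Proof.
move=> bf bg; rewrite /L2inner -cintegralZ.
  by congr cintegral; apply/funext => x; rewrite mulrA.
by apply: bounded_measurableM => //; exact: bounded_measurableJ.
Qed.

Lemma L2innerZr (z : R[i]) f g : bounded_measurable f -> bounded_measurable g ->
  L2inner mu f (fun x => z * g x) = z^*%C * L2inner mu f g.
Proof.
move=> bf bg; rewrite /L2inner -cintegralZ.
  by congr cintegral; apply/funext => x; rewrite rmorphM mulrCA.
by apply: bounded_measurableM => //; exact: bounded_measurableJ.
Qed.

Lemma L2inner_sum_eq0 (I : eqType) (s : seq I) (c : I -> R[i]) f
    (e : I -> T -> R[i]) :
  bounded_measurable f -> (forall i, bounded_measurable (e i)) ->
  (forall i, i \in s -> L2inner mu f (e i) = 0) ->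
  L2inner mu f (fun x => \sum_(i <- s) c i * e i x) = 0.
Proof.
move=> bf be; have bce i : bounded_measurable (fun x => c i * e i x).
  by apply: bounded_measurableM => //; exact: bounded_measurable_cst.
elim: s => [|i s ih] fe0.
  (* The empty sum is the zero function, viewed as the scalar 0 times a constant function so that
     [L2innerZr] gives the value 0. *)
  have := L2innerZr 0 bf (bounded_measurable_cst T (0 : R[i])).
  rewrite conjc0 [in RHS]mul0r => {2}<-; congr L2inner; apply/funext => x.
  by rewrite big_nil mul0r.
under eq_fun do rewrite big_cons.
rewrite L2innerDr//; last exact: bounded_measurable_sum.
rewrite L2innerZr// fe0 ?mem_head// mulr0 add0r ih// => j js.
by rewrite fe0// inE js orbT.
Qed.

Lemma bounded_measurable_in_L2 f : bounded_measurable f -> in_L2 mu f.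
Proof.
move=> bf; have [[mr _] [mj _]] := bf; split => //.
have /bounded_rmeasurable_integrable/integrableP[_] :=
  bounded_rmeasurableM (bounded_rmeasurable_normc bf)
                       (bounded_rmeasurable_normc bf).
rewrite /L2norm unlock => sq_lty; apply: poweR_lty.
under eq_integral => x _ do rewrite /= powR_mulrn// expr2 -normrM.
exact: sq_lty.
Qed.

(** A weak form of Cauchy-Schwarz: the uniform bound on [f] leaves the [L^1] norm of [g], which is
    at most its [L^2] norm because [mu] has total mass 1. *)
Lemma Re_L2inner_le f g (M : R) : bounded_measurable f -> bounded_measurable g ->
  (forall x, Normc.normc (f x) <= M) ->
  ((complex.Re (L2inner mu f g))%:E <= M%:E * L2norm mu g)%E.
Proof.
move=> bf bg fM.
have bnf := bounded_rmeasurable_normc bf.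
have bng := bounded_rmeasurable_normc bg.
have bJ := bounded_measurableM bf (bounded_measurableJ bg).
have M0 : 0 <= M := le_trans (normc_ge0 _) (fM point).
apply: (@le_trans _ _ (M * \int[mu]_x Normc.normc (g x))%:E).
  rewrite lee_fin -RintegralZl//; last exact: bounded_rmeasurable_integrable.
  apply: le_Rintegral => //.
  - by apply: bounded_rmeasurable_integrable; case: bJ.
  - apply: bounded_rmeasurable_integrable; apply: bounded_rmeasurableM => //.
    exact: bounded_rmeasurable_cst.
  - move=> x _; apply: (@le_trans _ _ (Normc.normc (f x * (g x)^*%C))).
      case: (f x * _) => a b /=; rewrite (le_trans (ler_norm _))//.
      by rewrite -sqrtr_sqr ler_wsqrtr// lerDl sqr_ge0.
    rewrite Normc.normcM; case: (g x) => a b /=; rewrite sqrrN.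
    by rewrite ler_wpM2r// sqrtr_ge0.
rewrite EFinM lee_wpmul2l// fineK; last first.
  exact/integrable_fin_num/bounded_rmeasurable_integrable.
(* Hölder with exponents 2 and 2 for the functions 1 and [|g|]; the [L^2] norm of 1 is 1. *)
have m1 : measurable_fun [set: T] (cst 1 : T -> R) by exact: measurable_cst.
have := @hoelder _ _ _ mu _ _ 2 2 m1 bng.1.
rewrite Lnorm_cst1 [X in (X `^ _)%E](_ : _ = 1%E); last exact: probability_setT.
rewrite poweR1r mul1e Lnorm1 => le12.
apply: le_trans (le12 _ _ _) => //; last by lra.
apply: ge0_le_integral => //.
- by move=> x _; rewrite lee_fin normc_ge0.
- exact/measurable_EFinP/bng.1.
- apply/measurableT_comp => //; apply/measurable_EFinP.
  by apply: measurable_funM => //; exact: bng.1.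
- by move=> x _ /=; rewrite mul1r lee_fin ler_norm.
Qed.

(** For a finite combination [p] of basis elements, orthogonality gives [<f, f> = <f, f - p>]. Since
    [f] is bounded, the right side has real part at most a constant times the norm of [f - p], which
    density makes arbitrarily small. *)
Lemma orthogonal_basis_Re_le0 (I : choiceType) (A : set I) (e : I -> T -> R[i]) f :
  orthonormal_basis mu A e -> (forall i, bounded_measurable (e i)) ->
  bounded_measurable f -> (forall i, A i -> L2inner mu f (e i) = 0) ->
  complex.Re (L2inner mu f f) <= 0.
Proof.
move=> [_ _ dense] be bf fe0; apply/ler_addgt0Pl => eps eps0; rewrite addr0.
have [_ [M fM]] := bounded_rmeasurable_normc bf.
(* A strictly positive bound for [f], by which [eps] can be divided. *)
have M0 : 0 < `|M| + 1 by rewrite ltr_wpDl.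
have [s [c [sA]]] :=
  dense f (bounded_measurable_in_L2 bf) (eps / (`|M| + 1)) (divr_gt0 eps0 M0).
set p := (fun x => \sum_(i <- s) c i * e i x).
set g := (fun x => f x - _) => gM.
have bp : bounded_measurable p.
  apply: bounded_measurable_sum => i.
  by apply: bounded_measurableM => //; exact: bounded_measurable_cst.
have gE : g = (fun x => f x + (-1) * p x).
  by apply/funext => x; rewrite mulN1r.
have bNp : bounded_measurable (fun x => (-1) * p x).
  by apply: bounded_measurableM => //; exact: bounded_measurable_cst.
have bg : bounded_measurable g by rewrite gE; exact: bounded_measurableD.
have -> : L2inner mu f f = L2inner mu f g.
  rewrite gE L2innerDr// L2innerZr// L2inner_sum_eq0 ?mulr0 ?addr0// => i.
  by move=> /sA; exact: fe0.
rewrite -lee_fin (le_trans (Re_L2inner_le (M := `|M| + 1) bf bg _))//.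
  move=> x; rewrite (le_trans (ler_norm _))// (le_trans (fM x))//.
  by rewrite (le_trans (ler_norm _))// lerDl.
apply: (@le_trans _ _ ((`|M| + 1)%:E * (eps / (`|M| + 1))%:E)%E).
  by apply: lee_wpmul2l; [rewrite lee_fin ltW | exact: ltW].
by rewrite -EFinM lee_fin mulrC divfK// gt_eqF.
Qed.

End inner_product.

(** * Exponential functions *)

Section exponential.
Context (R : realType) (mu : probability (measurableTypeR R) R).

Lemma bounded_measurable_exponential (l : R) : bounded_measurable (exponential l).
Proof.
have mul : measurable_fun setT (fun x : measurableTypeR R => 2 * pi * l * x).
  exact: measurable_funM.
split; split.
- apply: (measurableT_comp (f := @cos R)) => //.
  by apply: continuous_measurable_fun; exact: continuous_cos.
- by exists 1 => x; rewrite ler_norml cos_geN1 cos_le1.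
- apply: (measurableT_comp (f := @sin R)) => //.
  by apply: continuous_measurable_fun; exact: continuous_sin.
- by exists 1 => x; rewrite ler_norml sin_geN1 sin_le1.
Qed.

(** The product of one exponential with the conjugate of another is the exponential of the
    difference of frequencies. The inner product is thus a value of the Fourier transform of [mu],
    determined by that difference. *)
Lemma L2inner_exponential_shift (a b c d : R) : a - b = c - d ->
  L2inner mu (exponential a) (exponential b) =
  L2inner mu (exponential c) (exponential d).
Proof.
have expJ (l m : R) x :
    exponential l x * ((exponential m x)^*)%C = exponential (l - m) x.
  rewrite /exponential mulrBr mulrBl cosB sinB; simpc.
  by congr (_ +i* _); rewrite addrC.
by move=> abcd; congr cintegral; apply/funext => x; rewrite !expJ abcd.
Qed.

End exponential.

(** * Prime gaps and the contradiction with completeness *)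

Lemma polignac_gap (h : nat) : polignac_conjecture -> (0 < h)%N ->
  exists p q : nat, [/\ prime p, prime q & p = q + 2 * h]%N.
Proof.
(* An infinite set is nonempty, which yields one pair with the given gap. *)
move=> /[apply]; set S := [set _ | _]; have [->|/set0P[[p q]]] := eqVneq S set0.
  by move/(_ (finite_set0 _)).
move=> [[/= qp pp qltp _] pq] _.
by exists p, q; split => //; lia.
Qed.

Lemma prime_set_not_spectrum (R : realType) (mu : probability (measurableTypeR R) R) :
  polignac_conjecture -> ~ is_spectrum mu (@prime_set R).
Proof.
move=> polignac [_ basis]; have [_ orth _] := basis.
pose e (n : nat) := @exponential R n%:R.
pose ip m n := L2inner mu (e m) (e n).
have be (n : nat) : bounded_measurable (e n) by exact: bounded_measurable_exponential.
have primeR p : prime p -> @prime_set R p%:R by move=> pp; exists p.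
(* The difference of frequencies is 0, as for the prime 2 with itself; hence [e n] has norm 1 for
   composite [n] too. *)
have ip1 n : ip n n = 1.
  rewrite /ip (@L2inner_exponential_shift _ _ _ _ 2%:R 2%:R) ?subrr//.
  by rewrite orth ?eqxx//; exact: primeR.
(* Two primes with gap [2 * h] have orthogonal exponentials, and the shift carries this to [m] and
   [n], in both orders. *)
have ip0 m n h : (0 < h)%N -> m = (n + 2 * h)%N -> ip m n = 0 /\ ip n m = 0.
  move=> h0 ->; have [p [q [pp qp pE]]] := polignac_gap polignac h0.
  have pq : p != q by lia.
  rewrite /ip /e (@L2inner_exponential_shift _ _ _ _ p%:R q%:R); last first.
    by rewrite pE !natrD; ring.
  rewrite (@L2inner_exponential_shift _ _ n%:R _ q%:R p%:R); last first.
    by rewrite pE !natrD; ring.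
  by rewrite !orth ?eqr_nat ?(negbTE pq) ?[q == p]eq_sym ?(negbTE pq)//; exact: primeR.
(* One homogeneous linear equation in two unknowns has a nonzero solution: [(1, 0)] if the
   coefficient of [a] vanishes, and otherwise the two coefficients swapped with one sign changed. *)
have [a [b [ab0 abE]]] : exists a b : R[i],
    (a != 0) || (b != 0) /\ a * ip 9%N 2%N + b * ip 15 2 = 0.
  have [i0|i0] := eqVneq (ip 9%N 2) 0.
    by exists 1, 0; rewrite oner_eq0 i0 mulr0 mul0r addr0.
  by exists (- ip 15 2), (ip 9%N 2); rewrite i0 orbT; split => //; ring.
pose f x := a * e 9%N x + b * e 15%N x.
have bZ z n : bounded_measurable (fun x => z * e n x).
  by apply: bounded_measurableM => //; exact: bounded_measurable_cst.
have bf : bounded_measurable f by exact: bounded_measurableD.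
have fl g : bounded_measurable g ->
    L2inner mu f g = a * L2inner mu (e 9%N) g + b * L2inner mu (e 15%N) g.
  by move=> bg; rewrite L2innerDl// !L2innerZl.
have fr n : L2inner mu (e n) f = (a^* * ip n 9%N + b^* * ip n 15%N)%C.
  by rewrite L2innerDr// !L2innerZr.
have f_orth i : prime_set i -> L2inner mu f (exponential i) = 0.
  move=> [p /= pp <-]; rewrite fl; last exact: be.
  rewrite -/(e p) -/(ip _ _) -/(ip _ _).
  (* At the prime 2 orthogonality is the equation [abE]; at an odd prime both terms vanish
     separately, since 9 and 15 are odd and composite. *)
  have [->//|p2] := eqVneq p 2%N.
  have ip_odd n : odd n -> ~~ prime n -> ip n p = 0.
    move=> on pn.
    have op : odd p by case/even_prime: pp p2 => [->|].
    have np : n != p by apply: contraNneq pn => ->.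
    (* Distinct odd numbers differ by twice the difference of their halves, which is the [h] passed
       to [ip0]. *)
    have := odd_double_half n; have := odd_double_half p; rewrite on op => pE nE.
    have [ltnp|ltpn] : (n < p \/ p < n)%N by lia.
    - by apply: (ip0 p n (p./2 - n./2)%N _ _).2; lia.
    - by apply: (ip0 n p (n./2 - p./2)%N _ _).1; lia.
  by rewrite !ip_odd// !mulr0 addr0.
have := orthogonal_basis_Re_le0 basis (@bounded_measurable_exponential R) bf f_orth.
(* As [15 = 9 + 2 * 3], the cross terms vanish and [<f, f>] becomes [|a|^2 + |b|^2]. *)
rewrite fl// !fr !ip1; have [-> ->] := @ip0 15%N 9%N 3%N isT erefl.
rewrite !mulr0 !mulr1 addr0 add0r; apply/negP; rewrite -ltNge.
move: ab0; case: (a) => ar ai; case: (b) => br bi; rewrite !eq_complex -!negb_and /= => nz.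
(* The real part is a sum of four squares, zero only if [a] and [b] both vanish. *)
rewrite !mulrN !opprK -!expr2 lt_neqAle addr_ge0 ?addr_ge0 ?sqr_ge0// andbT eq_sym.
by rewrite !paddr_eq0 ?addr_ge0 ?sqr_ge0// !sqrf_eq0.
Qed.

Theorem corollary1p8 (R : realType) (polignac : polignac_conjecture) :
  (~ exists mu : probability (measurableTypeR R) R,
       is_spectrum mu (@prime_set R)) /\
  (~ exists mu : probability (measurableTypeR R) R,
       singular_continuous mu /\ is_spectrum mu (@prime_set R)).
Proof.
split=> [[mu]|[mu [_]]]; exact: prime_set_not_spectrum.
Qed.
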